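(* Let $K$ be a finite field with $q$ elements, let $w_1,w_2$ be positive integers with $\gcd(w_1,w_2)=1$, and let $\chi$ be the characteristic function of $Q=\langle w_1,w_2\rangle\subset\mathbb{N}$. Let $0\leq d\leq w_1w_2(q-1)-w_1-w_2$. Write $d=kw_1w_2+l$, where $k\geq 0$ and $0\leq l<w_1w_2$ are integers. Then $\dim_K C_{\mathbb{T}}(d)=k+\chi(l)$, where $C_{\mathbb{T}}(d)$ is the weighted projective Reed--Muller code of order $d$ over $\mathbb{T}(w_1,w_2)$.
   Context: $\mathbb{N}=\{0,1,2,\dots\}$. The weighted projective space $\mathbb{P}(w_1,w_2)$ is the quotient $(K^2\setminus 0)/K^*$, where $\lambda\in K^*$ acts by $\lambda(x_1,x_2)=(\lambda^{w_1}x_1,\lambda^{w_2}x_2)$. The weighted projective torus is $\mathbb{T}(w_1,w_2)=\{(x_1,x_2)\in\mathbb{P}(w_1,w_2): x_1x_2\neq 0\}$. The polynomial ring $K[t_1,t_2]$ is graded by $\deg(t_1)=w_1$, $\deg(t_2)=w_2$. Let $m=|\mathbb{T}(w_1,w_2)|$ and fix systems of homogeneous coordinates $\underline{x}_1,\dots,\underline{x}_m\in K^2$ of the points of $\mathbb{T}(w_1,w_2)$. For $d\geq 0$ let $\operatorname{ev}_d\colon K[t_1,t_2]_d\to K^m$ be $f\mapsto(f(\underline{x}_1),\dots,f(\underline{x}_m))$. The image of $\operatorname{ev}_d$ is $C_{\mathbb{T}}(d)$, the weighted projective Reed--Muller code over $\mathbb{T}(w_1,w_2)$ of order $d$ (its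 dimension does not depend on the choice of coordinates). $Q=\langle w_1,w_2\rangle$ is the submonoid of $\mathbb{N}$ generated by $w_1,w_2$, and $\chi\colon\mathbb{N}\to\{0,1\}$ is given by $\chi(n)=1$ if $n\in Q$ and $\chi(n)=0$ otherwise. *)

(* Defs.v *)
From HB Require Import structures.
From mathcomp Require Import all_boot all_order all_algebra.
From mathcomp Require Import boolp.
From mathcomp Require Import mpoly.

Set Implicit Arguments.
Unset Strict Implicit.
Unset Printing Implicit Defensive.

Import GRing.Theory.
Local Open Scope ring_scope.

Section WeightedProjectiveTorus.

Variables (K : finFieldType) (w1 w2 : nat).

Definition wact (a : K) (x : K * K) : K * K := (a ^+ w1 * x.1, a ^+ w2 * x.2).

Definition worbit (x : K * K) : {set K * K} := [set wact a x | a : K & a != 0].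

(* P(w1, w2) is represented by the set of K^*-orbits on K^2 \ 0. *)
Definition wproj : {set {set K * K}} := [set worbit x | x : K * K & x != 0].

(* The condition x_1 x_2 != 0 is constant on each orbit, so "some" and "every"
   representative give the same set. *)
Definition wtorus : {set {set K * K}} :=
  [set P in wproj | [exists x in P, x.1 * x.2 != 0]].

(* One representative in K^2 for each point of the torus, listed without
   repetition in an arbitrary order. *)
Definition homogeneous_coords (m : nat) (x : 'I_m -> K * K) : Prop :=
  injective (fun i => worbit (x i)) /\ [set worbit (x i) | i : 'I_m] = wtorus.

End WeightedProjectiveTorus.

(* The grading of K[t_1, t_2] with deg t_1 = w1 and deg t_2 = w2: K[t_1, t_2]_d
   is the set of polynomials f such that f \is d.-homog for wdeg w1 w2. *)
Definition wdeg (w1 w2 : nat) (mon : 'X_{1..2}) : nat :=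
  (mon ord0 * w1 + mon ord_max * w2)%N.

Fact wdeg0 w1 w2 : wdeg w1 w2 0%MM = 0%N.
Proof. by rewrite /wdeg !mnm0E. Qed.

Fact wdegD w1 w2 : {morph wdeg w1 w2 : m1 m2 / (m1 + m2)%MM >-> (m1 + m2)%N}.
Proof. by move=> m1 m2; rewrite /wdeg !mnmDE !mulnDl addnACA. Qed.

HB.instance Definition _ w1 w2 :=
  isMeasure.Build 2 (wdeg w1 w2) (wdeg0 w1 w2) (wdegD w1 w2).

Section Code.

Variables (K : finFieldType) (m : nat) (x : 'I_m -> K * K) (w1 w2 d : nat).

Definition ev (f : {mpoly K[2]}) : 'rV[K]_m :=
  \row_(i < m) f.@[tnth [tuple (x i).1; (x i).2]].

Definition ev_image (c : 'rV[K]_m) : Prop :=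
  exists2 f : {mpoly K[2]}, f \is d.-homog for (wdeg w1 w2) & c = ev f.

(* The span only packages the image of ev_d as a {vspace 'rV[K]_m}: by
   mem_wprm_code below, taking it adds no vectors. *)
Definition wprm_code : {vspace 'rV[K]_m} :=
  <<enum [pred c | `[< ev_image c >]]>>%VS.

Lemma mem_wprm_code c : (c \in wprm_code) <-> ev_image c.
Proof.
rewrite /wprm_code; set s := enum _.
have sP b : (b \in s) <-> ev_image b.
  by rewrite mem_enum inE; split=> /asboolP.
split=> [/(@coord_span _ _ _ (in_tuple s)) -> | /sP]; last exact: memv_span.
apply: (big_ind ev_image).
- exists 0; first exact: dhomog0.
  by apply/rowP=> i; rewrite !mxE meval0.
- move=> _ _ [f hf ->] [g hg ->]; exists (f + g); first exact: dhomogD.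
  by apply/rowP=> i; rewrite !mxE mevalD.
move=> i _; have /sP [f hf ->] : s`_i \in s by exact: mem_nth.
exists (coord (in_tuple s) i c *: f); first exact: dhomogZ.
by apply/rowP=> j; rewrite !mxE mevalZ.
Qed.

End Code.

Definition monoidQ (w1 w2 n : nat) : Prop :=
  exists a b : nat, n = (a * w1 + b * w2)%N.

Definition chi (w1 w2 n : nat) : nat := if `[< monoidQ w1 w2 n >] then 1 else 0.

(* Main.v *)
(* The monomials of weighted degree d are t_1^(a + j w2) t_2^(b - j w1) for
   0 <= j <= b / w1, where d = a w1 + b w2 with a < w2. At a point x of the
   torus the j-th one takes the value (x_1^a x_2^b) s^j with
   s = x_1^w2 / x_2^w1, and s takes every value of K^* on the torus. A linear
   relation between their evaluations is therefore a polynomial of degree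
   <= b / w1 < q - 1 vanishing on K^*, hence trivial, and the dimension of the
   code is the number b / w1 + 1 of monomials. *)
Require Import Defs.
From mathcomp Require Import all_boot all_order all_algebra.
From mathcomp Require Import boolp.
From mathcomp Require Import zify.
From mathcomp Require Import mpoly.

Import GRing.Theory.

(** The Chinese remainder theorem supplies a multiple of [w1] congruent to [l] modulo [w2]; its
    quotient by [w1] may then be reduced modulo [w2]. *)
Lemma coprime_repr (w1 w2 l : nat) : 0 < w2 -> coprime w1 w2 ->
  exists2 a, a < w2 & a * w1 = l %[mod w2].
Proof.
move=> w2_gt0 co; exists (chinese w2 w1 l 0 %/ w1 %% w2); first by rewrite ltn_mod.
have dv : w1 %| chinese w2 w1 l 0.
  by rewrite /dvdn chinese_modr 1?coprime_sym // mod0n.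
by rewrite modnMml divnK // chinese_modl // coprime_sym.
Qed.

(** Since [w1] is invertible modulo [w2], the first coefficients agree modulo [w2], and [a < w2] is
    the least in its class, so the shift is nonnegative. This enumerates the monomials of a given
    degree. *)
Lemma weighted_repr_shift (w1 w2 a b a' b' : nat) : 0 < w1 -> 0 < w2 ->
  coprime w1 w2 -> a < w2 -> a * w1 + b * w2 = a' * w1 + b' * w2 ->
  exists2 j, a' = a + j * w2 & b = b' + j * w1.
Proof.
move=> w1_gt0 w2_gt0 co lta e.
have /eqP : a' * w1 = a * w1 %[mod w2].
  by rewrite -(modnMDl b') addnC -e addnC modnMDl.
have le : a <= a'.
  rewrite leqNgt; apply/negP => lt.
  have : w2 %| (a - a') * w1.
    have -> : (a - a') * w1 = (b' - b) * w2 by rewrite !mulnBl; lia.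
    exact: dvdn_mull.
  rewrite Gauss_dvdl 1?coprime_sym // => /dvdn_leq; lia.
rewrite eqn_mod_dvd ?leq_mul2r ?le ?orbT // -mulnBl Gauss_dvdl 1?coprime_sym //.
case/dvdnP => j ej; have ea : a' = a + j * w2 by lia.
exists j => //; apply/eqP; rewrite -(eqn_pmul2r w2_gt0); apply/eqP.
by move: e; rewrite ea !mulnDl; lia.
Qed.

Section Evaluation.
Local Open Scope ring_scope.

Context {K : finFieldType} {m : nat}.
Implicit Type x : 'I_m -> K * K.

Definition mon2 (a b : nat) : 'X_{1..2} := [multinom if i == ord0 then a else b | i < 2].

Lemma wdeg_mon2 w1 w2 a b : wdeg w1 w2 (mon2 a b) = (a * w1 + b * w2)%N.
Proof. by rewrite /wdeg /mon2 !mnmE. Qed.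

Lemma mon2E (mon : 'X_{1..2}) : mon = mon2 (mon ord0) (mon ord_max).
Proof.
apply/mnmP => i; rewrite /mon2 mnmE.
by case: i => [[|[|i]] lt] //=; congr (mon _); apply: val_inj.
Qed.

Lemma ev_mon2 x a b i :
  ev x 'X_[mon2 a b] 0 i = (x i).1 ^+ a * (x i).2 ^+ b.
Proof.
by rewrite mxE mevalX !big_ord_recl big_ord0 mulr1 /mon2 !mnmE.
Qed.

Lemma ev_sum_monomials x (f : {mpoly K[2]}) :
  ev x f = \sum_(mon <- msupp f) f@_mon *: ev x 'X_[mon].
Proof.
apply/rowP => i; rewrite {1}[f]mpolyE mxE raddf_sum summxE.
by apply: eq_bigr => mon _; rewrite mxE [LHS]mevalZ mxE.
Qed.

Lemma wprm_code_subv x w1 w2 d (V : {vspace 'rV[K]_m}) :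
  (forall a b, (a * w1 + b * w2)%N = d -> ev x 'X_[mon2 a b] \in V) ->
  (wprm_code x w1 w2 d <= V)%VS.
Proof.
move=> sub; apply/subvP => _ /mem_wprm_code [f /dhomogP hf ->].
rewrite ev_sum_monomials big_seq; apply: memv_suml => mon hmon.
apply: memvZ; rewrite (mon2E mon); apply: sub.
by rewrite -wdeg_mon2 -mon2E; apply: hf.
Qed.

Lemma ev_mon2_code x w1 w2 d a b : (a * w1 + b * w2)%N = d ->
  ev x 'X_[mon2 a b] \in wprm_code x w1 w2 d.
Proof.
move=> e; apply/mem_wprm_code; exists 'X_[mon2 a b] => //.
by rewrite dhomogX -e; apply/eqP; exact: wdeg_mon2.
Qed.

Lemma homogeneous_coords_neq0 w1 w2 x i : homogeneous_coords w1 w2 x ->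
  ((x i).1 != 0) && ((x i).2 != 0).
Proof.
case=> _ hx; have : worbit w1 w2 (x i) \in wtorus K w1 w2.
  by rewrite -hx; apply/imsetP; exists i.
rewrite inE => /andP [_ /existsP [y /andP [/imsetP [a a0 ->]]]] /=.
by rewrite !mulf_eq0 !negb_or => /andP [/andP [_ ->] /andP [_ ->]].
Qed.

(** With a Bezout relation [u * w1 = v * w2 + 1], the point [(s ^- v, s ^- u)] has ratio [s]; the
    ratio is constant on orbits, so the chosen representative has it too. *)
Lemma torus_ratio_surj w1 w2 x : (0 < w1)%N -> (0 < w2)%N -> coprime w1 w2 ->
  homogeneous_coords w1 w2 x ->
  forall s : K, s != 0 -> exists i, (x i).1 ^+ w2 / (x i).2 ^+ w1 = s.
Proof.
move=> w1_gt0 w2_gt0 co hx s s0.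
case: (egcdnP w2 w1_gt0) => u v uv _.
have {}uv : (u * w1 = v * w2 + 1)%N by rewrite uv (eqP co).
pose y : K * K := (s ^- v, s ^- u).
have y1 : y.1 != 0 by rewrite invr_eq0 expf_neq0.
have y2 : y.2 != 0 by rewrite invr_eq0 expf_neq0.
have : worbit w1 w2 y \in wtorus K w1 w2.
  rewrite inE; apply/andP; split.
    apply/imsetP; exists y => //; rewrite inE.
    by apply: contraNneq y1 => ->.
  apply/existsP; exists y; rewrite mulf_neq0 // andbT.
  apply/imsetP; exists 1; first by rewrite inE oner_neq0.
  by rewrite /wact !expr1n !mul1r; case: (y).
case: (hx) => _ <- /imsetP [i _ eqo]; exists i.
have : x i \in worbit w1 w2 y.
  rewrite eqo; apply/imsetP; exists 1; first by rewrite inE oner_neq0.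
  by rewrite /wact !expr1n !mul1r; case: (x i).
case/imsetP => a; rewrite inE => a0 -> /=.
rewrite !exprMn -!exprM [(w2 * w1)%N]mulnC -mulf_div divff ?expf_neq0 // mul1r.
by rewrite !exprVn invrK -!exprM uv exprD mulKf ?expf_neq0.
Qed.

Lemma poly0_of_units (p : {poly K}) : (size p < #|K|)%N ->
  (forall s, s != 0 -> p.[s] = 0) -> p = 0.
Proof.
move=> sz hp; apply/eqP; apply: contraTT sz => p0; rewrite -leqNgt.
have /(max_poly_roots p0) : all (root p) (enum (predC1 (0 : K))).
  by apply/allP => s; rewrite mem_enum => s0; apply/rootP/hp.
rewrite enum_uniq -cardE cardC1 => /(_ isT); exact: leq_trans (leqSpred _).
Qed.

Lemma dim_wprm_code x w1 w2 a b : (0 < w1)%N -> (0 < w2)%N -> coprime w1 w2 ->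
  homogeneous_coords w1 w2 x -> (a < w2)%N -> ((b %/ w1).+1 < #|K|)%N ->
  \dim (wprm_code x w1 w2 (a * w1 + b * w2)) = (b %/ w1).+1.
Proof.
move=> w1_gt0 w2_gt0 co hx lta ltN; set N := (b %/ w1).+1.
have jb (j : 'I_N) : (j * w1 <= b)%N by rewrite -leq_divRL // -ltnS.
pose X := [tuple ev x 'X_[mon2 (a + j * w2) (b - j * w1)] | j < N].
have XE (j : 'I_N) : X`_j = ev x 'X_[mon2 (a + j * w2) (b - j * w1)].
  by rewrite -tnth_nth tnth_mktuple.
have freeX : free X.
  apply/freeP => c hc j.
  have p0 : \poly_(i < N) c (inord i) = 0.
    apply: poly0_of_units => [|s s0]; first exact: leq_ltn_trans (size_poly _ _) ltN.
    have [i <-] := torus_ratio_surj w1 w2 x w1_gt0 w2_gt0 co hx s s0.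
    have /andP [x1 x2] := homogeneous_coords_neq0 w1 w2 x i hx.
    have /rowP /(_ i) := hc; rewrite summxE mxE => hci.
    (* Scaled by this nonzero factor, the value of the polynomial at the ratio is the [i]-th
       coordinate of the relation [hc]. *)
    apply: (mulfI (mulf_neq0 (expf_neq0 a x1) (expf_neq0 b x2))).
    rewrite mulr0 -{}hci horner_poly mulr_sumr; apply: eq_bigr => k _.
    rewrite XE inord_val mxE ev_mon2 mulrCA; congr (_ * _).
    rewrite expr_div_n -!exprM [(w2 * k)%N]mulnC [(w1 * k)%N]mulnC.
    rewrite exprD mulrACA; congr (_ * _).
    by rewrite -{1}(subnK (jb k)) exprD mulfK // expf_neq0.
  by move/polyP/(_ j): p0; rewrite coef_poly coef0 ltn_ord inord_val.
have -> : wprm_code x w1 w2 (a * w1 + b * w2) = <<X>>%VS.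
  apply: subv_anti; apply/andP; split.
    apply: wprm_code_subv => a' b' e.
    have [j ea eb] := weighted_repr_shift w1 w2 a b a' b' w1_gt0 w2_gt0 co lta (esym e).
    have ltj : (j < N)%N by rewrite ltnS leq_divRL // eb leq_addl.
    apply: memv_span; apply/tnthP; exists (Ordinal ltj).
    by rewrite tnth_mktuple /= ea eb addnK.
  apply/span_subvP => _ /tnthP [j ->]; rewrite tnth_mktuple.
  apply: ev_mon2_code; rewrite !mulnDl mulnBl -!mulnA [(w1 * w2)%N]mulnC -addnA.
  by rewrite subnKC // [(w2 * w1)%N]mulnC mulnA leq_mul2r jb orbT.
by move/eqP: freeX; rewrite size_tuple.
Qed.

End Evaluation.

(* The bound d <= w1 * w2 * (q - 1) - w1 - w2 is compared in int, since its
   right-hand side may be negative. *)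
Theorem proposition4p1 (K : finFieldType) (q : nat) (hq : #|K| = q)
    (w1 w2 : nat) (hw1 : 0 < w1) (hw2 : 0 < w2) (hw : gcdn w1 w2 = 1)
    (m : nat) (hm : m = #|wtorus K w1 w2|)
    (x : 'I_m -> K * K) (hx : homogeneous_coords w1 w2 x)
    (d : nat)
    (hd : (d%:Z <= w1%:Z * w2%:Z * (q%:Z - 1) - w1%:Z - w2%:Z)%R)
    (k l : nat) (hl : l < w1 * w2) (hdkl : d = k * (w1 * w2) + l) :
  \dim (wprm_code x w1 w2 d) = k + chi w1 w2 l.
Proof.
have co : coprime w1 w2 by apply/eqP.
have ltk : k.+1 < #|K|.
  have : k * (w1 * w2) < (q - 1) * (w1 * w2) by nia.
  rewrite ltn_pmul2r ?muln_gt0 ?hw1 // hq; lia.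
have [a lta /eqP ea] := coprime_repr w1 w2 l hw2 co.
(* As [a] is the least possible coefficient of [w1], this comparison decides whether [l] lies in
   Q. *)
have [le | lt] := leqP (a * w1) l.
  move: ea; rewrite eq_sym eqn_mod_dvd // => /dvdnP [b eb].
  have el : l = a * w1 + b * w2 by lia.
  have ltb : b < w1 by rewrite -(ltn_pmul2r hw2); lia.
  have -> : chi w1 w2 l = 1 by rewrite /chi; case: asboolP => // -[]; exists a, b.
  have -> : d = a * w1 + (k * w1 + b) * w2 by rewrite hdkl el; lia.
  by rewrite dim_wprm_code // divnMDl // (divn_small ltb) addn0 // addn1.
move: ea; rewrite eqn_mod_dvd 1?ltnW // => /dvdnP [c ec].
have ltc : 0 < c < w1.
  apply/andP; split; first by case: c ec => //; lia.
  rewrite -(ltn_pmul2r hw2) -ec (leq_ltn_trans (leq_subr _ _)) //.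
  by rewrite mulnC ltn_pmul2l.
(* Otherwise [a * w1 + 0 * w2 = a' * w1 + (b' + c) * w2], and the shift lemma gives
   [0 = b' + c + j * w1], against [0 < c]. *)
have notQ a' b' : l != a' * w1 + b' * w2.
  apply/eqP => el.
  have [|j _ e] := weighted_repr_shift w1 w2 a 0 a' (b' + c) hw1 hw2 co lta.
    by rewrite mulnDl; lia.
  by lia.
have -> : chi w1 w2 l = 0.
  by rewrite /chi; case: asboolP => // -[a' [b' /eqP]]; rewrite (negPf (notQ _ _)).
(* For [k = 0] there is no monomial of degree [d = l], so the code is zero. Otherwise one block
   [w1 * w2] is borrowed to absorb [- c * w2], which costs one monomial. *)
rewrite addn0; case: k ltk hdkl => [_ | k ltk] hdkl.
  apply/eqP; rewrite dimv_eq0 -subv0; apply: wprm_code_subv => a' b' e.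
  by have := notQ a' b'; rewrite e hdkl mul0n eqxx.
have -> : d = a * w1 + (k * w1 + (w1 - c)) * w2.
  have : c * w2 <= w1 * w2 by rewrite leq_mul2r; lia.
  by rewrite hdkl mulSn mulnDl mulnBl mulnA; lia.
have ltwc : w1 - c < w1 by lia.
have eN : (k * w1 + (w1 - c)) %/ w1 = k by rewrite divnMDl // divn_small // addn0.
by rewrite dim_wprm_code // eN // ltnW.
Qed.
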